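(* Let $\mathbb{S}$ be a metric space, let the sequence of measures $\{\mu_n\}_{n\ge 1}$ on $\mathbb{S}$ converge weakly to a finite measure $\mu$ on $\mathbb{S}$, let $\{f_n\}_{n\ge 1}$ be an equicontinuous sequence of real-valued functions on $\mathbb{S}$ such that the integrals $\int_{\mathbb{S}} f_n\,d\mu_n$ are defined, and let $f$ be a measurable real-valued function on $\mathbb{S}$. If the sequence $\{f_n\}_{n\ge 1}$ converges to $f$ in measure $\mu$ and is asymptotically uniformly integrable with respect to $\{\mu_n\}_{n\ge 1}$, then $$\lim_{n\to\infty}\int_{\mathbb{S}} f_n(s)\,\mu_n(ds)=\int_{\mathbb{S}} f(s)\,\mu(ds).$$
   Context: Metric spaces carry their Borel $\sigma$-field. The integral $\int h\,d\mu$ of a measurable $[-\infty,+\infty]$-valued function is defined if $\min\{\int h^+d\mu,\int h^-d\mu\}<+\infty$ (with $h^+=\max\{h,0\}$, $h^-=-\min\{h,0\}$), and then equals $\int h^+d\mu-\int h^-d\mu$. Weak convergence: $\{\mu_n\}$ converges weakly to a finite measure $\mu$ if $\int h\,d\mu_n\to\int h\,d\mu$ for every bounded continuous function $h$ on $\mathbb{S}$ (so $\mu_n$ is finite for all sufficiently large $n$). Equicontinuity (pointwise): for each $s\in\mathbb{S}$ and $\varepsilon>0$ there is $\delta>0$ such that $|f_n(s')-f_n(s)|<\varepsilon$ for all $s'\in B_\delta(s)$ (open ball) and all $n\ge 1$. Convergence in measure $\mu$: for each $\varepsilon>0$, $\mu(\{s:|f_n(s)-f(s)|\ge\varepsilon\})\to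 0$. Asymptotic uniform integrability: $\{h_n\}$ is asymptotically uniformly integrable with respect to $\{\mu_n\}$ if $\lim_{K\to+\infty}\limsup_{n\to\infty}\int |h_n(s)|\,\mathbf{1}\{|h_n(s)|\ge K\}\,\mu_n(ds)=0$. *)

(* Defs.v *)
From HB Require Import structures.
From mathcomp Require Import all_boot all_order all_algebra.
From mathcomp Require Import all_classical all_reals all_analysis.

Set Implicit Arguments.
Unset Strict Implicit.
Unset Printing Implicit Defensive.

Import Order.TTheory GRing.Theory Num.Theory.
Import numFieldNormedType.Exports.

Local Open Scope classical_set_scope.
Local Open Scope ring_scope.

HB.mixin Record isBorel (d : measure_display) T
    & Measurable d T & Topological T := {
  measurable_open_generated : @measurable d T = <<s @open T >>
}.

(* Metric spaces carrying their Borel sigma-field. Measurable types are pointed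
   in the library, so these spaces are nonempty. *)
#[short(type="borelMetricType")]
HB.structure Definition BorelMetric (d : measure_display) (R : numDomainType) :=
  { T of Measurable d T & Metric R T & isBorel d T }.

Section definitions.
Context {d : measure_display} {R : realType} {S : borelMetricType d R}.

(* The library integral is total, with value -oo when both parts are infinite;
   this is the condition under which it has its usual meaning. *)
Definition integral_defined (mu : {measure set S -> \bar R}) (h : S -> \bar R) :=
  (Order.min (\int[mu]_x h^\+ x) (\int[mu]_x h^\- x) < +oo)%E.

Definition weak_cvg (mu_ : {measure set S -> \bar R}^nat)
    (mu : {measure set S -> \bar R}) :=
  forall h : S -> R, continuous h -> bounded_fun h ->
    (\int[mu_ n]_x (h x)%:E)%E @[n --> \oo] --> (\int[mu]_x (h x)%:E)%E.

Definition cvg_in_measure (mu : {measure set S -> \bar R})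
    (f_ : (S -> R)^nat) (f : S -> R) :=
  forall e : R, 0 < e ->
    mu [set s | e <= `|f_ n s - f s|] @[n --> \oo] --> 0%E.

Definition asymptotically_uniformly_integrable
    (mu_ : {measure set S -> \bar R}^nat) (h_ : (S -> R)^nat) :=
  limn_esup (fun n =>
    (\int[mu_ n]_s (`|h_ n s| * \1_[set t | K <= `|h_ n t|] s)%:E)%E)
    @[K --> +oo%R] --> 0%E.

(* The library's entourage-based equicontinuity is, for real-valued functions
   on a metric space, the pointwise epsilon-delta notion. *)
Lemma equicontinuous_epsilon_delta (f_ : (S -> R)^nat) :
  equicontinuous setT f_ <->
  forall s (e : R), 0 < e -> exists2 delta : R, 0 < delta &
    forall s', ball s delta s' -> forall n, `|f_ n s' - f_ n s| < e.
Proof.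
split=> [eqf s e e0|H s E /= [e /= e0 eE]].
  have := eqf s [set xy | ball xy.1 e xy.2] (entourage_ball R (PosNum e0)).
  move=> /nbhs_ballP[delta /= d0 dP]; exists delta => // s' /dP + n.
  by move=> /(_ n I); rewrite /ball /= distrC.
have [delta d0 dP] := H s e e0.
apply/nbhs_ballP; exists delta => //= s' /dP sP n _.
by apply: eE; rewrite /= distrC.
Qed.

End definitions.

(* Main.v *)
(* For bounded f_n the upper bound goes by contradiction: if the integrals of
   f_n exceeded that of f by e for infinitely many n, one could pick such n_j
   with mu(|f_(n_j) - f| >= eta) <= eta / 2^(j+1).  By equicontinuity
   h = sup_j f_(n_j) is a bounded continuous function, it dominates every
   f_(n_j), and h <= f + eta off a set of measure at most eta; weak convergence
   tested on the single function h gives the contradiction.  No separability of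
   the space is used.  Unbounded f_n are truncated at level K; the truncation
   error is at most the tail integral controlled by asymptotic uniform
   integrability. *)
Require Import Defs.
From mathcomp Require Import all_boot all_order all_algebra.
From mathcomp Require Import all_classical all_reals all_analysis.
From mathcomp Require Import measurable_realfun lra.

Set Implicit Arguments.
Unset Strict Implicit.
Unset Printing Implicit Defensive.

Import Order.TTheory GRing.Theory Num.Theory.
Import numFieldNormedType.Exports.

Local Open Scope classical_set_scope.
Local Open Scope ring_scope.

(** * Integrability of bounded functions *)

Lemma bounded_fun_le (T : Type) (R : realType) (h : T -> R) M :
  (forall s, `|h s| <= M) -> bounded_fun h.
Proof.
move=> hM; exists M; split; first exact: num_real.
by move=> x Mx s _ /=; exact: le_trans (hM s) (ltW Mx).
Qed.

Lemma bounded_integrable d (T : measurableType d) (R : realType)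
    (mu : {measure set T -> \bar R}) (h : T -> R) M :
  (mu setT < +oo)%E -> measurable_fun setT h -> (forall s, `|h s| <= M) ->
  mu.-integrable setT (EFin \o h).
Proof.
move=> mufin mh hM; apply: measurable_bounded_integrable => //.
exact: bounded_fun_le hM.
Qed.

(** * Weak convergence and bounded equicontinuous sequences *)

Section bounded_equicontinuous.
Context {d : measure_display} {R : realType} {S : borelMetricType d R}.

Lemma continuous_borel_measurable (h : S -> R) :
  continuous h -> measurable_fun setT h.
Proof.
move=> /continuousP ch; apply: (measurability _ (RGenOpens.measurableE R)).
move=> _ [_ [a [b ->] <-]]; rewrite setTI measurable_open_generated.
by apply: sub_gen_smallest; apply: ch; exact: interval_open.
Qed.

(** Tested on the constant 1, weak convergence makes the total masses converge to the finite number
    [mu setT]. *)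
Lemma weak_cvg_finite (mu_ : nat -> {measure set S -> \bar R})
    (mu : {finite_measure set S -> \bar R}) :
  weak_cvg mu_ mu -> \forall n \near \oo, (mu_ n setT < +oo)%E.
Proof.
move=> w.
have b1 : bounded_fun (cst 1 : S -> R).
  by apply: (@bounded_fun_le _ _ _ 1) => s; rewrite normr1.
have int1 (nu : {measure set S -> \bar R}) :
    (\int[nu]_s (cst (1 : R) s)%:E = nu setT)%E.
  by rewrite -[RHS]mul1e -integral_cst.
have fin : (\int[mu]_s (cst (1 : R) s)%:E)%E \is a fin_num.
  by rewrite int1 fin_num_measure.
have c1 : continuous (cst 1 : S -> R) by exact: cst_continuous.
have := w _ c1 b1; rewrite -(fineK fin) => /cvg_is_fine.
by apply: filterS => n; rewrite int1 ge0_fin_numE.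
Qed.

Lemma weak_cvg_Rintegral (mu_ : nat -> {measure set S -> \bar R})
    (mu : {finite_measure set S -> \bar R}) (h : S -> R) M :
  weak_cvg mu_ mu -> continuous h -> (forall s, `|h s| <= M) ->
  \int[mu_ n]_s h s @[n --> \oo] --> \int[mu]_s h s.
Proof.
move=> w ch hM; apply: fine_cvg.
rewrite fineK; first exact: w ch (bounded_fun_le hM).
apply: integrable_fin_num => //; apply: bounded_integrable hM.
- by rewrite ltey_eq fin_num_measure.
- exact: continuous_borel_measurable.
Qed.

(** At each point one radius [delta] serves all members of the family, hence also their supremum.
    The bound [M] ensures that every [sup] is a genuine supremum. *)
Lemma equicontinuous_sup_continuous (f_ : nat -> S -> R) M (nu : nat -> nat) :
  equicontinuous setT f_ -> (forall n s, `|f_ n s| <= M) ->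
  continuous (fun s => sup (range (fun j => f_ (nu j) s))).
Proof.
move=> /equicontinuous_epsilon_delta ef fM s.
have ubM t : has_ubound (range (fun j => f_ (nu j) t)).
  by exists M => _ [j _ <-]; exact: le_trans (ler_norm _) (fM _ _).
have sup_le t t' e : (forall n, f_ n t <= f_ n t' + e) ->
    sup (range (fun j => f_ (nu j) t)) <= sup (range (fun j => f_ (nu j) t')) + e.
  move=> tt'; apply: ge_sup; first by exists (f_ (nu 0%N) t), 0%N.
  move=> _ [j _ <-]; apply: le_trans (tt' _) _; rewrite lerD2r.
  by apply: ub_le_sup => //; exists j.
apply/cvgrPdist_le => e e0; have [delta d0 fd] := ef s e e0.
apply/nbhs_ballP; exists delta => //= t /fd ft.
rewrite ler_distlC lerBlDr; apply/andP; split; apply: sup_le => n;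
  by have := ltW (ft n); rewrite ler_distlC lerBlDr => /andP[].
Qed.

Lemma Rintegral_limsup_le (mu_ : nat -> {measure set S -> \bar R})
    (mu : {finite_measure set S -> \bar R})
    (g_ : nat -> S -> R) (g : S -> R) (M e : R) :
  weak_cvg mu_ mu -> equicontinuous setT g_ -> measurable_fun setT g ->
  (forall n s, `|g_ n s| <= M) -> (forall s, `|g s| <= M) ->
  cvg_in_measure mu g_ g -> 0 < e ->
  \forall n \near \oo, \int[mu_ n]_s g_ n s <= \int[mu]_s g s + e.
Proof.
move=> w eg mg gnM gM cg e0.
have mufin : (mu setT < +oo)%E by rewrite ltey_eq fin_num_measure.
have M0 : 0 <= M by apply: le_trans (gM point).
pose C := fine (mu setT).
have C0 : 0 <= C by exact: fine_ge0.
(* Replacing [g] by [g + eta + 2 * M * \1_A] with [mu A <= eta] raises the integral by at most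
   [eta * (C + 2 * M)], which has to stay below [e / 2]. The [+ 1] keeps the divisor positive. *)
pose eta : R := e / 2 / (C + 2 * M + 1).
have D0 : 0 < C + 2 * M + 1 by lra.
have eta0 : 0 < eta by rewrite !divr_gt0.
have etaE : eta * (C + 2 * M) <= e / 2.
  rewrite /eta mulrAC ler_pdivrMr// ler_wpM2l; lra.
have mgn n : measurable_fun setT (g_ n).
  exact: continuous_borel_measurable (equicontinuous_continuous eg I).
apply: contrapT => notnear.
(* Failure of the eventual bound leaves bad indices beyond every [j], so they can be taken where the
   other two eventual properties hold as well. The masses [eta / 2 ^ j.+1] sum to [eta]. *)
have ex j : exists n, [/\ (j <= n)%N, (mu_ n setT < +oo)%E,
    (mu [set s | (eta <= `|g_ n s - g s|)%R] <= (eta / (2 ^ j.+1)%:R)%:E)%E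
    & \int[mu]_s g s + e < \int[mu_ n]_s g_ n s].
  have ej : 0 < eta / (2 ^ j.+1)%:R :> R by rewrite divr_gt0// ltr0n expn_gt0.
  apply: contrapT => noex; apply: notnear; near=> n.
  rewrite leNgt; apply/negP => bad; apply: noex; exists n; split => //.
  - by near: n; exists j.
  - by near: n; exact: weak_cvg_finite w.
  - near: n; have /fine_cvgP[fin] := cg eta eta0.
    move=> /cvgrPdist_le /(_ _ ej); apply: filterS2 fin => n /fineK <-.
    by rewrite sub0r normrN lee_fin ger0_norm// fine_ge0.
have [nu nuP] := choice ex.
pose h s := sup (range (fun j => g_ (nu j) s)).
have ch : continuous h by exact: equicontinuous_sup_continuous eg gnM.
have ubM t : has_ubound (range (fun j => g_ (nu j) t)).
  by exists M => _ [j _ <-]; exact: le_trans (ler_norm _) (gnM _ _).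
have h_ge j s : g_ (nu j) s <= h s by apply: ub_le_sup => //; exists j.
have hM s : `|h s| <= M.
  rewrite ler_norml; apply/andP; split.
    apply: le_trans (h_ge 0%N s).
    by have := gnM (nu 0%N) s; rewrite ler_norml => /andP[].
  apply: ge_sup; first by exists (g_ (nu 0%N) s), 0%N.
  by move=> _ [j _ <-]; exact: le_trans (ler_norm _) (gnM _ _).
pose A := \bigcup_j [set s | eta <= `|g_ (nu j) s - g s|].
have mA_ j : measurable [set s | eta <= `|g_ (nu j) s - g s|].
  rewrite -[X in measurable X]setTI.
  apply: (@measurable_fun_le _ _ _ setT (cst eta)
    (fun s => `|g_ (nu j) s - g s|)) => //.
  by apply: measurableT_comp => //; exact: measurable_funB.
have mA : measurable A by exact: bigcup_measurable.
have muA : fine (mu A) <= eta.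
  rewrite -lee_fin fineK ?fin_num_measure//.
  apply: le_trans (measure_sigma_subadditive mu mA_ mA (@subset_refl _ A)) _.
  apply: le_trans (epsilon_trick0 xpredT (ltW eta0)).
  by apply: lee_nneseries => [//|j _]; have [_ _ + _] := nuP j.
(* On [A] all functions take values in [[-M, M]], so they differ by at most [2 * M]; off [A] every
   selected [g_ (nu j)] is within [eta] of [g]. *)
have h_le s : h s <= g s + (eta + 2 * M * \1_A s).
  apply: ge_sup; first by exists (g_ (nu 0%N) s), 0%N.
  move=> _ [j _ <-]; rewrite indicE; case: (boolP (s \in A)) => sA /=.
    have := gnM (nu j) s; have := gM s.
    by rewrite !ler_norml => /andP[? ?] /andP[? ?]; lra.
  have : `|g_ (nu j) s - g s| < eta.
    by rewrite ltNge; apply: contra sA => ?; rewrite inE; exists j.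
  rewrite ltr_norml => /andP[_ ?]; lra.
have ig : mu.-integrable setT (EFin \o g) by exact: bounded_integrable gM.
have icst : mu.-integrable setT (EFin \o (cst eta : S -> R)).
  by apply: (@bounded_integrable _ _ _ _ _ eta) => // s; rewrite ger0_norm// ltW.
have iA0 : mu.-integrable setT (EFin \o (\1_A : S -> R)).
  apply: (@bounded_integrable _ _ _ _ _ 1) => // s.
  by rewrite indicE ger0_norm// lern1 leq_b1.
have iA : mu.-integrable setT (EFin \o (fun s => 2 * M * \1_A s : R)).
  have -> : EFin \o (fun s => 2 * M * \1_A s : R) =
    (fun s => (2 * M)%:E * (EFin \o \1_A) s)%E by [].
  exact: integrableZl.
have icA : mu.-integrable setT (EFin \o (fun s => eta + 2 * M * \1_A s : R)).
  exact: (integrableD _ icst iA).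
have igcA : mu.-integrable setT
    (EFin \o (fun s => g s + (eta + 2 * M * \1_A s) : R)).
  exact: (integrableD _ ig icA).
have ih (m : {measure set S -> \bar R}) : (m setT < +oo)%E ->
    m.-integrable setT (EFin \o h).
  move=> mfin; apply: bounded_integrable hM => //.
  exact: continuous_borel_measurable.
have inth : \int[mu]_s h s <= \int[mu]_s g s + e / 2.
  have := le_Rintegral measurableT (ih _ mufin) igcA (fun s _ => h_le s).
  move=> /le_trans; apply.
  rewrite RintegralD// lerD2l RintegralD// RintegralZl// Rintegral_cst//.
  have -> : \int[mu]_s (\1_A s) = fine (mu A).
    by rewrite /Rintegral integral_indic// setIT.
  apply: le_trans etaE; rewrite -/C mulrDr lerD2l mulrC ler_wpM2r//; lra.
have e20 : 0 < e / 2 by rewrite divr_gt0.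
have /cvgrPdist_lt/(_ _ e20)[N _ NP] := weak_cvg_Rintegral w ch hM.
(* Since [N <= nu N], weak convergence on [h] applies at the bad index [nu N]. Its error [e / 2] and
   the [e / 2] of [inth] contradict the excess [e]. *)
have [Nn fN _ bad] := nuP N.
have := NP _ Nn; rewrite /= ltr_distlC => /andP[_].
have : \int[mu_ (nu N)]_s g_ (nu N) s <= \int[mu_ (nu N)]_s h s.
  apply: le_Rintegral => //; last exact: ih.
  exact: bounded_integrable (gnM _).
lra.
Unshelve. all: by end_near. Qed.

(** * Bounded 1-Lipschitz images of the sequence *)

Lemma equicontinuous_comp_lip (f_ : nat -> S -> R) (phi : R -> R) :
  (forall x y, `|phi x - phi y| <= `|x - y|) ->
  equicontinuous setT f_ -> equicontinuous setT (fun n => phi \o f_ n).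
Proof.
move=> lip /equicontinuous_epsilon_delta ef; apply/equicontinuous_epsilon_delta.
move=> s e /(ef s)[delta d0 fd]; exists delta => // t /fd ft n.
exact: le_lt_trans (lip _ _) (ft n).
Qed.

Lemma cvg_in_measure_comp_lip (mu : {measure set S -> \bar R})
    (f_ : nat -> S -> R) (f : S -> R) (phi : R -> R) :
  (forall x y, `|phi x - phi y| <= `|x - y|) ->
  equicontinuous setT f_ -> measurable_fun setT f ->
  measurable_fun setT phi ->
  cvg_in_measure mu f_ f -> cvg_in_measure mu (fun n => phi \o f_ n) (phi \o f).
Proof.
move=> lip ef mf mphi cf e e0.
have mfn n : measurable_fun setT (f_ n).
  exact: continuous_borel_measurable (equicontinuous_continuous ef I).
have mdist (u v : S -> R) : measurable_fun setT u -> measurable_fun setT v ->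
    measurable [set s | e <= `|u s - v s|].
  move=> mu' mv; rewrite -[X in measurable X]setTI.
  apply: (@measurable_fun_le _ _ _ setT (cst e) (fun s => `|u s - v s|)) => //.
  by apply: measurableT_comp => //; exact: measurable_funB.
apply: (@squeeze_cvge _ _ _ _ (fun=> 0%E) _ _ _ _ _ (cf e e0)).
- apply: nearW => n; rewrite measure_ge0/=; apply: le_measure; rewrite ?inE.
  + by apply: mdist; exact: measurableT_comp.
  + exact: mdist.
  + by move=> s /= /le_trans; apply; exact: lip.
- exact: cvg_cst.
Qed.

(** The one-sided bound is applied to [phi] and to [- phi]. It is meant for [phi] a truncation or
    the absolute value of one, which reduces unbounded [f_] to the bounded case. *)
Lemma Rintegral_comp_cvg (mu_ : nat -> {measure set S -> \bar R})
    (mu : {finite_measure set S -> \bar R})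
    (f_ : nat -> S -> R) (f : S -> R) (phi : R -> R) M :
  weak_cvg mu_ mu -> equicontinuous setT f_ -> measurable_fun setT f ->
  cvg_in_measure mu f_ f ->
  (forall x y, `|phi x - phi y| <= `|x - y|) -> measurable_fun setT phi ->
  (forall x, `|phi x| <= M) ->
  \int[mu_ n]_s phi (f_ n s) @[n --> \oo] --> \int[mu]_s phi (f s).
Proof.
move=> w ef mf cf lip mphi phiM.
have upper (psi : R -> R) : (forall x y, `|psi x - psi y| <= `|x - y|) ->
    measurable_fun setT psi -> (forall x, `|psi x| <= M) -> forall e, 0 < e ->
    \forall n \near \oo, \int[mu_ n]_s psi (f_ n s) <= \int[mu]_s psi (f s) + e.
  move=> psilip mpsi psiM e e0; apply: (@Rintegral_limsup_le _ _
    (fun n => psi \o f_ n) (psi \o f) M) => //.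
  - exact: equicontinuous_comp_lip.
  - exact: measurableT_comp.
  - by move=> *; exact: psiM.
  - by move=> *; exact: psiM.
  - exact: cvg_in_measure_comp_lip.
have intN (nu : {measure set S -> \bar R}) (u : S -> R) :
    (nu setT < +oo)%E -> measurable_fun setT u ->
    \int[nu]_s - phi (u s) = - \int[nu]_s phi (u s).
  move=> nufin mu'.
  have iu : nu.-integrable setT (EFin \o (phi \o u)).
    apply: (@bounded_integrable _ _ _ _ _ M) => // [|s]; last exact: phiM.
    exact: measurableT_comp.
  rewrite -[RHS]mulN1r -(RintegralZl _ measurableT iu).
  by apply: eq_Rintegral => s _; rewrite mulN1r.
apply/cvgrPdist_le => e e0; near=> n.
have fn : (mu_ n setT < +oo)%E by near: n; exact: weak_cvg_finite w.
rewrite ler_distlC; apply/andP; split; last first.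
  by near: n; exact: upper.
have : \int[mu_ n]_s - phi (f_ n s) <= \int[mu]_s - phi (f s) + e.
  near: n; apply: (upper (fun x => - phi x)) => //.
  - by move=> x y; rewrite -opprD normrN.
  - exact: measurableT_comp.
  - by move=> x; rewrite normrN.
have mfn : measurable_fun setT (f_ n).
  exact: continuous_borel_measurable (equicontinuous_continuous ef I).
have mufin : (mu setT < +oo)%E by rewrite ltey_eq fin_num_measure.
by rewrite (intN _ _ fn mfn) (intN _ _ mufin mf); lra.
Unshelve. all: by end_near. Qed.

End bounded_equicontinuous.

(** * Eventual bounds from a limit superior, and truncation *)

Lemma limn_esup_lt_near (R : realType) (u : nat -> \bar R) a :
  (limn_esup u < a)%E -> \forall n \near \oo, (u n < a)%E.
Proof.
(* [limn_esup] is an infimum, over neighbourhoods of infinity, of suprema; one of these suprema is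
   already below [a]. *)
move=> /ereal_inf_lt[_ [V nV <-] Va]; apply: filterS nV => n Vn.
by apply: le_lt_trans Va; apply: ereal_sup_ubound; exists n.
Qed.

Section truncation.
Context {R : realType}.
Implicit Types K x y : R.

(** Truncation to [[-K, K]] when [0 <= K]. Unlike cutting off to 0 above level [K], it is
    1-Lipschitz, so it preserves equicontinuity and convergence in measure. *)
Definition clamp K x : R := Num.max (- K) (Num.min x K).

Lemma clamp_lip K x y : `|clamp K x - clamp K y| <= `|x - y|.
Proof.
rewrite ler_norml; have := ler_norm (x - y); have := ler_norm (y - x).
rewrite [`|y - x|]distrC /clamp => xy yx; apply/andP.
by case: (ltP x K) => ?; case: (ltP y K) => ?;
  repeat (case: (ltP (- K) _) => ?); lra.
Qed.

Lemma normr_clamp_le K x : 0 <= K -> `|clamp K x| <= K.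
Proof.
move=> K0; rewrite ler_norml /clamp; apply/andP.
by case: (ltP x K) => ?; case: (ltP (- K) _) => ?; lra.
Qed.

Lemma clamp_id K x : `|x| <= K -> clamp K x = x.
Proof.
rewrite ler_norml /clamp => /andP[? ?].
by rewrite min_l// max_r.
Qed.

(** Supplies the monotonicity in the level that monotone convergence asks for. *)
Lemma normr_clamp_homo x K L : 0 <= K -> K <= L ->
  `|clamp K x| <= `|clamp L x|.
Proof.
move=> K0 KL; have [xK|Kx] := leP `|x| K.
  by rewrite !clamp_id// (le_trans xK).
apply: le_trans (normr_clamp_le _ K0) _.
have [xL|Lx] := leP `|x| L; first by rewrite clamp_id// ltW.
rewrite /clamp; case: (ltP x L) => ?; case: (ltP (- L) _) => ?;
  move: Lx; rewrite ?lter_normr => /orP[];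
  rewrite ?ler_normr; lra.
Qed.

Lemma normr_sub_clamp_le K x : 0 <= K -> `|x - clamp K x| <= `|x|.
Proof.
move=> K0; rewrite ler_norml /clamp; apply/andP.
by have [x0|x0] := ger0P x; case: (ltP x K) => ?; case: (ltP (- K) _) => ?; lra.
Qed.

Lemma normr_clamp_le_normr K x : 0 <= K -> `|clamp K x| <= `|x|.
Proof.
move=> K0; have [xK|Kx] := leP `|x| K; first by rewrite clamp_id.
exact: le_trans (normr_clamp_le _ K0) (ltW Kx).
Qed.

Lemma measurable_clamp K : measurable_fun setT (clamp K).
Proof.
by apply: measurable_maxr => //; exact: measurable_minr.
Qed.

End truncation.

(** * Tail integrals and the truncation error *)

Section tails.
Context {d : measure_display} {T : measurableType d} {R : realType}.
Context (nu : {measure set T -> \bar R}) (f : T -> R).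
Context (mf : measurable_fun setT f).

Local Notation tail K := (fun s => `|f s| * \1_[set t | K <= `|f t|] s).

Lemma measurable_tail (K : R) : measurable_fun setT (tail K).
Proof.
have mnf : measurable_fun setT (fun s => `|f s|) by exact: measurableT_comp.
apply: measurable_funM => //; apply: measurable_indic.
rewrite -[X in measurable X]setTI.
exact: (@measurable_fun_le _ _ _ setT (cst K)).
Qed.

Lemma tail_ge0 (K : R) s : 0 <= tail K s.
Proof. by rewrite mulr_ge0// indicE ler0n. Qed.

Lemma tail_integrable (K : R) : (\int[nu]_s (tail K s)%:E < +oo)%E ->
  nu.-integrable setT (EFin \o tail K).
Proof.
move=> h; apply/integrableP; split; first exact/measurable_EFinP/measurable_tail.
by under eq_integral do rewrite /= ger0_norm ?tail_ge0//.
Qed.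

Context (nufin : (nu setT < +oo)%E).

Lemma normr_le_tail (K : R) s : 0 <= K -> `|f s| <= K + tail K s.
Proof.
move=> K0; rewrite /= indicE; case: (boolP (s \in _)) => [_|].
  by rewrite mulr1 lerDr.
by rewrite notin_setE /= => /negP; rewrite -ltNge mulr0 addr0 => /ltW.
Qed.

(** The dominating function [K + tail K] is integrable because the total mass is finite. *)
Lemma integrable_tail (K : R) : 0 <= K ->
  (\int[nu]_s (tail K s)%:E < +oo)%E -> nu.-integrable setT (EFin \o f).
Proof.
move=> K0 /tail_integrable it.
have ik : nu.-integrable setT (EFin \o (cst K : T -> R)).
  exact: (@bounded_integrable _ _ _ _ _ `|K|).
apply: (le_integrable _ _ _ (integrableD _ ik it)) => //.
  exact/measurable_EFinP.
move=> s _ /=; rewrite lee_fin [leRHS]ger0_norm ?addr_ge0 ?tail_ge0//.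
exact: normr_le_tail.
Qed.

(** Truncation changes nothing where [|f| < K] and changes [f] by at most [|f|] elsewhere, so the
    error is dominated pointwise by the tail. *)
Lemma Rintegral_clamp_dist (K e : R) : 0 <= K ->
  (\int[nu]_s (tail K s)%:E < e%:E)%E ->
  `|\int[nu]_s f s - \int[nu]_s clamp K (f s)| <= e.
Proof.
move=> K0 te; have tfin := lt_trans te (ltry e).
have it := tail_integrable tfin.
have iff := integrable_tail K0 tfin.
have mcf : measurable_fun setT (clamp K \o f).
  by apply: measurableT_comp => //; exact: measurable_clamp.
have ic : nu.-integrable setT (EFin \o (clamp K \o f)).
  apply: (le_integrable _ _ _ iff) => //; first exact/measurable_EFinP.
  by move=> s _; rewrite lee_fin normr_clamp_le_normr.
rewrite -RintegralB//.
have ib := integrableB measurableT iff ic.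
apply: le_trans (le_normr_Rintegral measurableT ib) _.
have tle : \int[nu]_s tail K s <= e.
  by rewrite -lee_fin fineK ?integrable_fin_num// ltW.
apply: le_trans tle; apply: le_Rintegral => //.
  exact: integrable_norm ib.
move=> s _; rewrite indicE; case: (boolP (s \in _)).
  by rewrite mulr1 normr_sub_clamp_le.
rewrite notin_setE /= => /negP; rewrite -ltNge mulr0 => /ltW fK.
by rewrite clamp_id// subrr normr0.
Qed.

End tails.

(** * Consequences of asymptotic uniform integrability *)

Section aui.
Context {d : measure_display} {R : realType} {S : borelMetricType d R}.
Context (mu_ : nat -> {measure set S -> \bar R})
  (mu : {finite_measure set S -> \bar R}) (f_ : nat -> S -> R) (f : S -> R).

(** For large [K] the limit superior is finite and below [e], hence so are the tails from some index
    on; that index may depend on [K]. *)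
Lemma aui_near (e : R) : asymptotically_uniformly_integrable mu_ f_ -> 0 < e ->
  \forall K \near +oo, \forall n \near \oo,
    (\int[mu_ n]_s (`|f_ n s| * \1_[set t | (K <= `|f_ n t|)%R] s)%:E < e%:E)%E.
Proof.
move=> /fine_cvgP[fin /cvgrPdist_lt cv] e0.
have := cv _ e0; apply: filterS2 fin => K Kfin /=.
rewrite sub0r normrN => /(le_lt_trans (ler_norm _)).
by rewrite -lte_fin fineK// => /limn_esup_lt_near.
Qed.

Context (w : weak_cvg mu_ mu) (ef : equicontinuous setT f_)
  (mf : measurable_fun setT f) (cf : cvg_in_measure mu f_ f)
  (ui : asymptotically_uniformly_integrable mu_ f_).

Let mufin : (mu setT < +oo)%E.
Proof. by rewrite ltey_eq fin_num_measure. Qed.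

Let mf_ n : measurable_fun setT (f_ n).
Proof. exact: continuous_borel_measurable (equicontinuous_continuous ef I). Qed.

Let tail_lt1 : exists2 K : R, 0 <= K & \forall n \near \oo,
  (\int[mu_ n]_s (`|f_ n s| * \1_[set t | (K <= `|f_ n t|)%R] s)%:E < 1%:E)%E.
Proof.
near (pinfty_nbhs R) => K; exists K; near: K.
- exact: nbhs_pinfty_ge.
- exact: aui_near.
Unshelve. all: by end_near. Qed.

Lemma near_integrable :
  \forall n \near \oo, (mu_ n).-integrable setT (EFin \o f_ n).
Proof.
have [K K0 Kn] := tail_lt1.
apply: filterS2 (weak_cvg_finite w) Kn => n fn /lt_trans/(_ (ltry 1)).
exact: integrable_tail.
Qed.

(* The integral of [|clamp k f|] is the limit of the integrals of
   [|clamp k f_n|], which the tails bound uniformly in [k]. *)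
Lemma limit_integrable : mu.-integrable setT (EFin \o f).
Proof.
have [K K0 Kn] := tail_lt1.
have mc k : measurable_fun setT (fun x => `|clamp k x| : R).
  by apply: measurableT_comp => //; exact: measurable_clamp.
have clip k : forall x y, `| `|clamp k x| - `|clamp k y| | <= `|x - y| :> R.
  by move=> x y; apply: le_trans (clamp_lip k x y); exact: ler_dist_dist.
have cb (k : nat) (x : R) : `| `|clamp k%:R x| | <= k%:R.
  by rewrite normr_id normr_clamp_le.
have mass : \forall n \near \oo, fine (mu_ n setT) <= fine (mu setT) + 1.
  have c1 : continuous (cst 1 : S -> R) by exact: cst_continuous.
  have b1 : forall s : S, `|cst (1 : R) s| <= 1 by move=> s; rewrite normr1.
  have /cvgrPdist_le/(_ _ ltr01) := weak_cvg_Rintegral w c1 b1.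
  apply: filterS => n; rewrite !Rintegral_cst// !mul1r ler_distlC.
  by case/andP.
(* Integral of [K + tail K] against [mu_ n]: the mass is eventually at most [fine (mu setT) + 1] and
   the tail at most 1. The truncation level [k] does not enter. *)
pose B := K * (fine (mu setT) + 1) + 1.
have bound k : \int[mu]_s `|clamp k%:R (f s)| <= B.
  have cv := Rintegral_comp_cvg w ef mf cf (clip k%:R) (mc k%:R) (cb k).
  apply: (cvgr_to_le cv); near=> n.
  have fn : (mu_ n setT < +oo)%E by near: n; exact: weak_cvg_finite w.
  have te : (\int[mu_ n]_s (`|f_ n s| * \1_[set t | (K <= `|f_ n t|)%R] s)%:E
    < 1%:E)%E by near: n.
  have it := tail_integrable (mf_ n) (lt_trans te (ltry 1)).
  have iK : (mu_ n).-integrable setT (EFin \o (cst K : S -> R)).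
    exact: (@bounded_integrable _ _ _ _ _ `|K|).
  have tle : \int[mu_ n]_s (`|f_ n s| * \1_[set t | (K <= `|f_ n t|)%R] s) <= 1.
    by rewrite -lee_fin fineK ?integrable_fin_num// ltW.
  have KM : K * fine (mu_ n setT) <= K * (fine (mu setT) + 1).
    by rewrite ler_wpM2l//; near: n.
  apply: le_trans (lerD KM tle).
  rewrite -Rintegral_cst// -RintegralD//; apply: le_Rintegral => //.
  - apply: (bounded_integrable fn _ (fun s => cb k (f_ n s))).
    exact: measurableT_comp (mc _) (mf_ n).
  - exact: (integrableD _ iK it).
  - move=> s _; apply: le_trans (normr_clamp_le_normr _ _) _ => //.
    exact: normr_le_tail.
apply/integrableP; split; first exact/measurable_EFinP.
(* Monotone convergence carries the bound [B] over to [|f|], since at each point the truncations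
   increase and equal [f s] once [k] reaches [|f s|]. *)
have cvm : (\int[mu]_s (`|clamp k%:R (f s)|)%:E)%E @[k --> \oo] -->
    (\int[mu]_s limn (fun k => (`|clamp k%:R (f s)|)%:E))%E.
  apply: (@cvg_monotone_convergence _ _ _ mu setT measurableT
    (fun k s => (`|clamp k%:R (f s)|)%:E)).
  - by move=> k; apply/measurable_EFinP; exact: measurableT_comp (mc _) mf.
  - by move=> k s _; rewrite lee_fin.
  - by move=> s _ k l kl; rewrite lee_fin normr_clamp_homo// ler_nat.
have -> : (\int[mu]_s `|(EFin \o f) s| =
    \int[mu]_s limn (fun k => (`|clamp k%:R (f s)|)%:E))%E.
  apply: eq_integral => s _; apply/esym/lim_near_cst => //.
  by apply: filterS (nbhs_infty_ger `|f s|) => k fk; rewrite clamp_id.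
apply: le_lt_trans (ltry B); apply: cvge_le cvm; apply: nearW => k.
rewrite -[leLHS]fineK ?lee_fin; first exact: bound.
apply: integrable_fin_num => //.
apply: (bounded_integrable mufin _ (fun s => cb k (f s))).
exact: measurableT_comp (mc _) mf.
Unshelve. all: by end_near. Qed.

(** Dominated convergence with the integrable bound [|f|]; at each point the truncated values are
    eventually constant. *)
Lemma Rintegral_clamp_cvg :
  \int[mu]_s clamp k%:R (f s) @[k --> \oo] --> \int[mu]_s f s.
Proof.
have iff := limit_integrable.
have mc k : measurable_fun setT (clamp (k%:R : R) \o f).
  by apply: measurableT_comp => //; exact: measurable_clamp.
have [|||||_ _ cv] := @dominated_convergence _ _ _ mu setT measurableT
  (fun k s => (clamp k%:R (f s))%:E) (EFin \o f) (abse \o (EFin \o f)).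
- by move=> k; apply/measurable_EFinP; exact: mc k.
- exact/measurable_EFinP.
- apply: aeW => s _.
  have near_eq : \forall k \near \oo, (clamp k%:R (f s))%:E = (f s)%:E :> \bar R.
    by apply: filterS (nbhs_infty_ger `|f s|) => k fk; rewrite clamp_id.
  exact: cvg_near_cst near_eq.
- exact: integrable_abse.
- by apply: aeW => s k _; rewrite lee_fin normr_clamp_le_normr.
- by apply: fine_cvg; rewrite fineK// integrable_fin_num.
Qed.

End aui.

(** * Passage from truncated to unbounded integrands *)

Theorem corollary5p2 (d : measure_display) (R : realType)
    (S : borelMetricType d R)
    (mu_ : nat -> {measure set S -> \bar R})
    (mu : {finite_measure set S -> \bar R})
    (f_ : nat -> S -> R) (f : S -> R) :
  weak_cvg mu_ mu ->
  equicontinuous setT f_ ->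
  (forall n, integral_defined (mu_ n) (EFin \o f_ n)) ->
  measurable_fun setT f ->
  cvg_in_measure mu f_ f ->
  asymptotically_uniformly_integrable mu_ f_ ->
  integral_defined mu (EFin \o f) /\
  (\int[mu_ n]_s (f_ n s)%:E)%E @[n --> \oo] --> (\int[mu]_s (f s)%:E)%E.
Proof.
move=> w ef _ mf cf ui.
have iff := limit_integrable w ef mf cf ui.
split.
  by rewrite /integral_defined gt_min integral_funepos_lt_pinfty.
have -> : (\int[mu]_s (f s)%:E)%E = (\int[mu]_s f s)%:E.
  by rewrite fineK// integrable_fin_num.
apply/fine_cvgP; split.
  apply: filterS (near_integrable w ef ui) => n.
  exact: integrable_fin_num.
apply/cvgrPdist_le => e e0.
have e3 : 0 < e / 3 by rewrite divr_gt0.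
(* One level [k] makes both truncation errors at most [e / 3]: that of [f_ n] under [mu_ n] for all
   large [n], through the tails, and that of [f] under [mu]. *)
have [k kn kf] : exists2 k : nat, (\forall n \near \oo,
    (\int[mu_ n]_s (`|f_ n s| * \1_[set t | (k%:R <= `|f_ n t|)%R] s)%:E
      < (e / 3)%:E)%E)
    & `|\int[mu]_s f s - \int[mu]_s clamp k%:R (f s)| <= e / 3.
  have [M [_ MP]] := aui_near ui e3.
  near \oo => k; exists k; last first.
    near: k; move/cvgrPdist_le : (Rintegral_clamp_cvg w ef mf cf ui).
    exact.
  apply: MP; near: k; exact: nbhs_infty_gtr.
(* The last third is the distance between the two truncated integrals at this fixed [k]. *)
have /cvgrPdist_le/(_ _ e3) := Rintegral_comp_cvg w ef mf cf
  (clamp_lip k%:R) (measurable_clamp k%:R) (fun x => normr_clamp_le x (ler0n R k)).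
apply: filterS3 (weak_cvg_finite w) kn => n fn kn cn /=.
have mfn := continuous_borel_measurable (equicontinuous_continuous ef I).
have := Rintegral_clamp_dist (mfn n) fn (ler0n R k) kn.
move: kf cn; rewrite !ler_norml => /andP[? ?] /andP[? ?] /andP[? ?].
rewrite -[fine _]/(\int[mu_ n]_s f_ n s); apply/andP; lra.
Unshelve. all: by end_near. Qed.
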